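(* Let $(M_n)_{n\ge 0}$ be the simple random walk on the oriented lattice $\mathbb{H}$ and let $(M_{\tau_n})_{n\ge 0}$ be its induced Markov chain on $\mathcal{V}_0=\mathbb{Z}\times\{0\}$. Then the Martin boundaries of the induced chain $(M_{\tau_n})_{n\ge0}$ and of the original chain $(M_n)_{n\ge0}$ are both trivial, i.e. for each of these two chains the only positive harmonic functions are the constant functions.
   Context: The oriented lattice $\mathbb{H}$ has vertex set $\mathbb{Z}^2$. Put $\epsilon_0=0$, $\epsilon_y=1$ for $y>0$, $\epsilon_y=-1$ for $y<0$. A pair $(u,v)\in\mathbb{Z}^2\times\mathbb{Z}^2$ is an oriented edge if and only if either $v_1=u_1$ and $v_2=u_2\pm1$, or $\epsilon_{u_2}\neq0$, $v_2=u_2$ and $v_1=u_1+\epsilon_{u_2}$. The simple random walk $(M_n)_{n\ge0}$, $M_n=(M_n^{(1)},M_n^{(2)})$, is the Markov chain on $\mathbb{Z}^2$ with kernel $P(u,v)=1/d_u^-$ if $(u,v)$ is an edge and $0$ otherwise, where $d_u^-$ is the number of edges with source $u$ (so $d_u^-=3$ if $u_2\ne0$ and $d_u^-=2$ if $u_2=0$). Let $\tau_0=0$ and $\tau_{n+1}=\inf\{t\ge\tau_n+1: M_t^{(2)}=0\}$; these stopping times are almost surely finite. The induced Markov chain is $(M_{\tau_n})_{n\ge0}$, which, when started in $\mathcal{V}_0=\mathbb{Z}\times\{0\}$, is a Markov chain on $\mathcal{V}_0\cong\mathbb{Z}$ with kernel $P_0(u,v)=\mathbf{P}^u(M_{\tau_1}=v)$.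 A function $h$ on the state space is harmonic for a kernel $Q$ if $\sum_v Q(u,v)h(v)=h(u)$ for all $u$. *)

(* Defs.v *)
From HB Require Import structures.
From mathcomp Require Import all_boot all_order all_algebra finmap.
From mathcomp Require Import all_classical all_reals all_analysis.

Set Implicit Arguments.
Unset Strict Implicit.
Unset Printing Implicit Defensive.

Import Order.TTheory GRing.Theory Num.Theory.

Local Open Scope classical_set_scope.
Local Open Scope ring_scope.

Definition state : Type := (int * int)%type.

(* [Num.sg y] is 0, 1 or -1 according to the sign of [y]. *)
Definition edge (u v : state) : bool :=
  ((v.1 == u.1) && ((v.2 == u.2 + 1) || (v.2 == u.2 - 1)))
  || [&& Num.sg u.2 != 0, v.2 == u.2 & v.1 == u.1 + Num.sg u.2].

(* [fset_set] is the empty set on infinite sets; here each vertex is the source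
   of only finitely many edges. *)
Definition outdeg (u : state) : nat := #|` fset_set [set v | edge u v]|.

Definition walk_kernel (R : realType) (u v : state) : R :=
  if edge u v then (outdeg u)%:R^-1 else 0.

(* [P u] is the law under which the chain starts from [u].  The last clause is
   the Markov property with transition kernel [Q], multiplied out so that
   conditioning events may be null. *)
Definition markov_chain (R : realType) (T : Type) (d : measure_display)
    (Omega : measurableType d) (Q : T -> T -> R)
    (P : T -> probability Omega R) (M : nat -> Omega -> T) : Prop :=
  [/\ forall n x, measurable (M n @^-1` [set x]),
      forall u, P u (M 0%N @^-1` [set u]) = 1%E &
      forall u n (x : nat -> T),
        P u [set w | forall i, (i <= n.+1)%N -> M i w = x i] =
        (P u [set w | forall i, (i <= n)%N -> M i w = x i]
         * (Q (x n) (x n.+1))%:E)%E].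

(* Infimum of a set of times; [None] is the infimum +oo of the empty set. *)
Definition inf_time (A : pred nat) : option nat :=
  match pselect (exists t, A t) with
  | left exA => Some (ex_minn exA)
  | right _ => None
  end.

Fixpoint tau (Omega : Type) (M : nat -> Omega -> state) (n : nat) (w : Omega)
    : option nat :=
  if n is n'.+1 then
    obind (fun s => inf_time (fun t => (s.+1 <= t)%N && ((M t w).2 == 0)))
          (tau M n' w)
  else Some 0%N.

Definition induced_chain (Omega : Type) (M : nat -> Omega -> state)
    (n : nat) (w : Omega) : option state :=
  omap (fun t => M t w) (tau M n w).

(* Kernel of the induced chain on Z x {0}, identified with Z. *)
Definition induced_kernel (R : realType) (d : measure_display)
    (Omega : measurableType d) (P : state -> probability Omega R)
    (M : nat -> Omega -> state) (x y : int) : R :=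
  fine (P (x, 0) [set w | induced_chain M 1 w = Some (y, 0)]).

(* "Positive" means nonnegative. For the stochastic kernels considered here the
   nonnegative and the strictly positive versions of triviality are equivalent
   (add the constant 1). *)
Definition positive_harmonic (R : realType) (T : choiceType) (Q : T -> T -> R)
    (h : T -> R) : Prop :=
  (forall u, 0 <= h u) /\
  (forall u, \esum_(v in [set: T]) (Q u v * h v)%:E = (h u)%:E).

Definition trivial_martin_boundary (R : realType) (T : choiceType)
    (Q : T -> T -> R) : Prop :=
  forall h : T -> R,
    positive_harmonic Q h <-> exists2 c : R, 0 <= c & forall u, h u = c.

(* Main.v *)
Require Import Defs.
From HB Require Import structures.
From mathcomp Require Import all_boot all_order all_algebra.
From mathcomp Require Import all_classical all_reals all_analysis.
From mathcomp Require Import finmap zify ring lra.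

(** Every constant is harmonic for the walk because its kernel is stochastic, and
for the induced chain because the vertical coordinate of the walk returns to 0
almost surely. The content is that a nonnegative harmonic function is constant.
Throughout, T is the horizontal translation by 1, which commutes with the walk,
and the axis is the line of second coordinate 0.

The engine is a local statement in the upper half-plane
([no_supercritical_growth]). Suppose that F >= 0 is harmonic above the axis and
that T F <= c F with c > 1. If T F were almost equal to c F at one point, then by
Harnack's inequality it would be so along a long vertical segment above that
point, and on this segment harmonicity would read
g (j + 1) + g (j - 1) = (3 - c) g j up to a small error. As 3 - c < 2, the
solutions of this recurrence oscillate and cannot stay positive. Hence
T F <= (c - e) F with e depending on c only. Taking the infimum of the admissible
constants c ([le_of_ratio_descent]) replaces the constant by 1.

Let h >= 0 be harmonic for the walk, and let v be the Poisson extension of its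
trace on the axis, that is, the mean of the trace at the point where the walk
first hits the axis; v is the least nonnegative function that has this trace and
is superharmonic off the axis. The argument has two steps.

- h = v ([harmonic_eq_poisson]). The defect f = h - v is nonnegative, vanishes on
  the axis and is harmonic off it, so by the engine it is nonincreasing in x in
  the upper half-plane and nondecreasing in the lower one. Let k be the sum of h
  and its image under the central symmetry, and m the infimum of k on the axis.
  The Poisson part of k is at least m everywhere, so one step of the walk from
  (x, 0) gives k (x, 0) >= m + (f (x, 1) + f (- x, 1)) / 2 >= m + f (0, 1) / 2,
  one of x and - x being nonpositive. Thus f (0, 1) = 0, and by translation,
  harmonicity and symmetry f = 0.

- h is constant on the axis ([axis_nonincreasing]). If T h <= c h on the axis,
  then this holds everywhere, because h is the Poisson extension of its trace; by
  the engine c can be lowered as long as c > 1. So h (x + 1, 0) <= h (x, 0), the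
  central symmetry gives the reverse inequality, and the Poisson extension of a
  constant is that constant ([poisson_cst]).

For the induced chain, a nonnegative function b on the axis that is harmonic for
the return kernel has a Poisson extension; at (x, 0) the mean of this extension
over the neighbours is the return kernel applied to b ([esum_return_kernel]), so
the extension is harmonic for the walk, hence constant ([return_trivial]). This
uses the return kernel only through its approximation by n-step hitting
probabilities, which the Markov property identifies with the law of the first
return ([cvg_induced_kernel]). *)

Set Implicit Arguments.
Unset Strict Implicit.
Unset Printing Implicit Defensive.

Import Order.TTheory GRing.Theory Num.Theory.
Import numFieldNormedType.Exports.

Local Open Scope classical_set_scope.
Local Open Scope ring_scope.

(** * Averages over the out-neighbours *)

Definition nbrs (u : state) : seq state :=
  [:: (u.1, u.2 + 1); (u.1, u.2 - 1)] ++
  (if u.2 == 0 then [::] else [:: (u.1 + Num.sg u.2, u.2)]).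
Arguments nbrs : simpl never.

Lemma nbrs_uniq u : uniq (nbrs u).
Proof.
case: u => x y; rewrite /nbrs /=.
by case: (y =P 0) => [->|ny] /=; rewrite !inE !xpair_eqE /=; lia.
Qed.

Lemma edgeE u v : edge u v = (v \in nbrs u).
Proof.
case: u v => x y [x' y']; rewrite /edge /nbrs /= sgr_eq0.
case: (y =P 0) => [->|ny] /=; rewrite !inE !xpair_eqE /=.
  by rewrite orbF andb_orr.
by rewrite andb_orr orbA [(y' == y) && _]andbC.
Qed.

Section Average.
Context {R : realType}.
Implicit Types (h : state -> R).

Definition avg h u : R := (\sum_(v <- nbrs u) h v) / (size (nbrs u))%:R.

Lemma avg0E h x : avg h (x, 0) = (h (x, 1) + h (x, -1)) / 2.
Proof. by rewrite /avg /nbrs /= !big_cons big_nil addr0. Qed.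

Lemma avg_gt0E h x y : 0 < y ->
  avg h (x, y) = (h (x, y + 1) + h (x, y - 1) + h (x + 1, y)) / 3.
Proof.
move=> y0; rewrite /avg /nbrs /= gt_eqF //= !big_cons big_nil addr0 gtr0_sg//.
by rewrite addrA.
Qed.

Lemma avg_le h h' u : (forall v, h v <= h' v) -> avg h u <= avg h' u.
Proof.
by move=> hh'; rewrite ler_wpM2r ?invr_ge0 ?ler0n//; apply: ler_sum => v _.
Qed.

Lemma avg_ge0 h u : (forall v, 0 <= h v) -> 0 <= avg h u.
Proof. by move=> h0; rewrite mulr_ge0 ?invr_ge0 ?ler0n// sumr_ge0. Qed.

Lemma avgD h h' u : avg (h \+ h') u = avg h u + avg h' u.
Proof. by rewrite /avg -mulrDl big_split. Qed.

Lemma avgB h h' u : avg (h \- h') u = avg h u - avg h' u.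
Proof. by rewrite /avg -mulrBl sumrB. Qed.

Lemma avgZ c h u : avg (c \*: h) u = c * avg h u.
Proof. by rewrite /avg mulrA mulr_sumr. Qed.

Lemma avg_cst c u : avg (fun=> c) u = c.
Proof.
rewrite /avg big_const_seq count_predT iter_addr addr0 -[c *+ _]mulr_natr mulfK//.
by rewrite pnatr_eq0.
Qed.

Definition translate (a : int) (u : state) : state := (u.1 + a, u.2).
(** Together with the horizontal translations, the central symmetry is what
preserves the orientation: a reflection in one axis alone reverses edges. *)
Definition reflect0 (u : state) : state := (- u.1, - u.2).

Lemma avg_translate a h u : avg (h \o translate a) u = avg h (translate a u).
Proof.
case: u => x y; rewrite /avg /nbrs /= /translate /=.
by case: (y == 0); rewrite /= !big_cons !big_nil /= ?(addrAC _ (Num.sg y)).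
Qed.

Lemma avg_reflect0 h u : avg (h \o reflect0) u = avg h (reflect0 u).
Proof.
case: u => x y; rewrite /avg /nbrs /= /reflect0 /= oppr_eq0.
case: (y == 0); rewrite /= !big_cons !big_nil /= ?sgrN !opprD ?opprK.
  by rewrite addrCA.
by rewrite addrCA.
Qed.

Lemma cvg_avg (hn : nat -> state -> R) h u :
  (forall v, hn n v @[n --> \oo] --> h v) -> avg (hn n) u @[n --> \oo] --> avg h u.
Proof.
move=> hnh; rewrite /avg; apply: cvgMr_tmp.
elim: (nbrs u) => [|w s IHs].
  by rewrite big_nil; under eq_fun do rewrite big_nil; exact: cvg_cst.
by rewrite big_cons; under eq_fun do rewrite big_cons; exact: cvgD.
Qed.

End Average.

(** * Harmonic functions in the upper half-plane *)

Section HalfPlane.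
Context {R : realType}.
Implicit Types (F f : state -> R).

(** If the conclusion fails at (x, y), let [g j] and [u j] be the values of F and
of c F - T F at (x, y + j). Harnack's inequality, one step of the walk at a time,
keeps [u j / g j] below (c - 1) / 2 for j <= L. Then the ratios r of successive
values of g satisfy r' <= 3 - c + (c - 1) / 2 - 1 / r <= r - (c - 1) / 2, since
r + 1 / r >= 2; starting from r <= 3 they become negative within L steps. *)
Lemma no_supercritical_growth (c : R) : 1 < c ->
  exists2 e : R, 0 < e & forall F,
    (forall x y, 0 <= y -> 0 <= F (x, y)) ->
    (forall x y, 0 < y -> avg F (x, y) = F (x, y)) ->
    (forall x y, 0 <= y -> F (x + 1, y) <= c * F (x, y)) ->
    forall x y, 0 < y -> F (x + 1, y) <= (c - e) * F (x, y).
Proof.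
move=> c1.
have [L Llarge] : exists L : nat, 3 < L%:R * ((c - 1) / 2).
  exists (Num.truncn (3 / ((c - 1) / 2))).+1.
  rewrite -ltr_pdivrMr; last lra.
  by rewrite truncnS_gt.
have p9 : 0 < 9 ^+ L :> R by rewrite exprn_gt0.
(* Each step upwards loses a factor 3 on u and a factor 3 on g. *)
exists ((c - 1) / 2 / 9 ^+ L); first by rewrite divr_gt0//; lra.
set e := _ / 9 ^+ L => F F0 Fh Fc x y y0.
have e0 : 0 < e by rewrite divr_gt0//; lra.
rewrite leNgt; apply/negP => Fce.
pose g j := F (x, y + j%:Z); pose u j := c * g j - F (x + 1, y + j%:Z).
have step j : 3 * g j = F (x + 1, y + j%:Z) + g j.+1 + F (x, y + j%:Z - 1).
  have yj : 0 < y + j%:Z by lia.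
  rewrite /g -{1}(Fh _ _ yj) (avg_gt0E _ _ yj).
  rewrite (_ : y + j.+1 = y + j%:Z + 1); last lia.
  lra.
(* c F - T F is harmonic above the axis and nonnegative, whence Harnack. *)
have ustep j : u j.+1 <= 3 * u j.
  have yj : 0 < y + j%:Z by lia.
  have := step j; have := Fh (x + 1) _ yj; rewrite avg_gt0E//.
  have := Fc x (y + j%:Z - 1); have := Fc (x + 1) (y + j%:Z).
  rewrite /u /g (_ : y + j.+1 = y + j%:Z + 1); last lia.
  move=> /(_ (ltW yj)) A1 A2 A3; have {}A2 := A2 ltac:(lia).
  nra.
have g0 j : 0 <= g j by apply: F0; lia.
have gstep j : g j <= 3 * g j.+1.
  have := step j.+1; have := F0 (x + 1) (y + j.+1); have := F0 x (y + j.+2).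
  rewrite -/(g j.+1) -/(g j.+2) (_ : y + j.+1 - 1 = y + j); last lia.
  rewrite -/(g j) => A1 A2; have {}A1 := A1 ltac:(lia).
  by have {}A2 := A2 ltac:(lia); lra.
have u00 : u 0%N < e * g 0%N by rewrite /u /g addr0; lra.
have u0 j : 0 <= u j by rewrite subr_ge0; apply: Fc; lia.
have gp j : 0 < g j.
  elim: j => [|j IH]; last by have := gstep j; lra.
  by have := u0 0%N; have := g0 0%N; nra.
have ub j : u j <= 9 ^+ j * e * g j.
  elim: j => [|j IH]; first by rewrite expr0 mul1r ltW.
  apply: (le_trans (ustep j)); rewrite exprS -[9 * _ * e]mulrA.
  have : 0 < 9 ^+ j * e by rewrite mulr_gt0// exprn_gt0.
  by have := gstep j; move: IH; move: (9 ^+ j * e) => a; nra.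
have ubL j : (j <= L)%N -> u j <= (c - 1) / 2 * g j.
  move=> jL; apply: (le_trans (ub j)); rewrite ler_pM2r//.
  rewrite /e mulrC -mulrA ler_piMr//; first lra.
  by rewrite ler_pdivrMl// mulr1 ler_eXn2l// ltr1n.
have riccati j : (j <= L)%N -> g j.+1 <= (3 - j%:R * ((c - 1) / 2)) * g j.
  elim: j => [_|j IH jL].
    have := step 0%N; have := F0 (x + 1) (y + 0%:Z) ltac:(lia).
    by have := F0 x (y + 0%:Z - 1) ltac:(lia); lra.
  have {}IH := IH (ltnW jL).
  have := step j.+1; have := ubL _ jL.
  rewrite /u (_ : y + j.+1 - 1 = y + j); last lia.
  rewrite -/(g j).
  move: IH; rewrite -[j.+1%:R]natr1 [(j%:R + 1) * _]mulrDl mul1r.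
  move: (j%:R * _) => s.
  have := gp j; have := gp j.+1; move: (g j) (g j.+1) (g j.+2).
  move: (F _) => T a b b' b0 a0 H1 H2 H3.
  suff : b' * a <= (3 - s - (c - 1) / 2) * b * a.
    by rewrite ler_pM2r//; lra.
  (* The inequality r + 1 / r >= 2 for r = b / a, cleared of denominators. *)
  have : 0 <= (b - a) ^+ 2 by rewrite sqr_ge0.
  rewrite expr2.
  have : b' <= (3 - c + (c - 1) / 2) * b - a by nra.
  nra.
have := riccati L (leqnn _); have := gp L; have := gp L.+1; nra.
Qed.

(** The admissible constants c >= 1 form a closed half-line, whose end point must
be 1, as otherwise it could be lowered. *)
Lemma le_of_ratio_descent (I : Type) (D : set I) (f g : I -> R) (c0 : R) :
  (forall i, D i -> 0 <= f i) ->
  (forall i, D i -> g i <= c0 * f i) ->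
  (forall c, 1 < c -> (forall i, D i -> g i <= c * f i) ->
    exists2 e, 0 < e & forall i, D i -> g i <= (c - e) * f i) ->
  forall i, D i -> g i <= f i.
Proof.
move=> f0 gc0 down; pose S : set R := [set c | forall i, D i -> g i <= c * f i].
have Sup c c' : S c -> c <= c' -> S c'.
  move=> Sc cc' i Di; apply: le_trans (Sc i Di) _.
  by apply: ler_wpM2r cc'; exact: f0.
suff S1 : S 1 by move=> i /S1; rewrite mul1r.
have [c01|c01] := leP c0 1; first exact: Sup gc0 c01.
pose A := S `&` [set c | 1 <= c].
have Ainf : has_inf A.
  by split; [exists c0; split => //=; exact: ltW | exists 1 => c []].
have Sinf : S (inf A).
  move=> i Di; apply/ler_addgt0Pr => e e0.
  have d0 : 0 < f i + 1 by have := f0 i Di; lra.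
  have [||a [Sa _] ae] := @inf_adherent _ A (e / (f i + 1)) => //.
    by rewrite divr_gt0.
  have : e / (f i + 1) * f i <= e.
    by rewrite -mulrA ler_piMr ?(ltW e0)// ler_pdivrMl//; lra.
  by have := Sup _ _ Sa (ltW ae) i Di; lra.
have inf1 : 1 <= inf A by apply: lb_le_inf; [exact: Ainf.1|move=> c []].
have [inf1'|?] := ltP 1 (inf A); last by apply: Sup Sinf _; lra.
have [e e0 Se] := down _ inf1' Sinf.
have : inf A <= Num.max 1 (inf A - e).
  apply: ge_inf; first exact: Ainf.2.
  by split; [apply: Sup Se _|]; rewrite /= le_max lexx// orbT.
rewrite le_max => /orP[]; lra.
Qed.

(** On the cone of such functions the translation is at most 3 times the
identity, a single step of the walk having probability 1/3; the previous two
lemmas bring this constant down to 1. The positive harmonic functions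
exp (l x) sinh (t y), with exp l = 3 - 2 cosh t, show the phenomenon: only
l <= 0 occurs. *)
Lemma half_plane_nonincreasing f :
  (forall x y, 0 <= y -> 0 <= f (x, y)) ->
  (forall x, f (x, 0) = 0) ->
  (forall x y, 0 < y -> avg f (x, y) = f (x, y)) ->
  forall x y, 0 <= y -> f (x + 1, y) <= f (x, y).
Proof.
move=> f0 fb fh x y y0.
apply: (@le_of_ratio_descent _ [set z : state | 0 <= z.2] f
  (f \o translate 1) 3 _ _ _ (x, y) y0).
- by case=> ? ?; exact: f0.
- move=> {y0}[{}x {}y] /=; rewrite /translate/=.
  rewrite le_eqVlt => /predU1P[<-|y0]; first by rewrite !fb mulr0.
  rewrite -(fh x y)// avg_gt0E//.
  have := f0 x (y + 1) ltac:(lia); have := f0 x (y - 1) ltac:(lia); lra.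
- move=> c c1 fc; have [e e0 He] := no_supercritical_growth c1.
  exists e => // -[x' y'] /=; rewrite /translate/= le_eqVlt.
  move=> /predU1P[<-|y'0]; first by rewrite !fb mulr0.
  by apply: He => // x'' y'' y''0; exact: (fc (x'', y'')).
Qed.

End HalfPlane.

(** * Poisson extension from the axis *)

Section Poisson.
Context {R : realType}.
Implicit Types (v h : state -> R) (b : int -> R).

Lemma cvgn_unique (u : nat -> R) (a b : R) :
  u @ \oo --> a -> u @ \oo --> b -> a = b.
Proof. by move=> ua ub; rewrite -(cvg_lim _ ua)// -(cvg_lim _ ub). Qed.

(** The mean of b at the point where the walk started at z first hits the axis,
on the event that this takes at most n steps. *)
Fixpoint poisson_iter b (n : nat) (z : state) : R :=
  if z.2 == 0 then b z.1
  else if n is n'.+1 then avg (poisson_iter b n') z else 0.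

(** A relation, because the Poisson extension of an arbitrary nonnegative b
may be infinite. *)
Definition poisson b v :=
  forall z, poisson_iter b n z @[n --> \oo] --> v z.

Lemma poisson_iter_boundary b n x : poisson_iter b n (x, 0) = b x.
Proof. by case: n. Qed.

Lemma poisson_iter_inner b n z : z.2 != 0 ->
  poisson_iter b n.+1 z = avg (poisson_iter b n) z.
Proof. by move=> /negPf z0; rewrite /= z0. Qed.

Lemma poisson_iter_ge0 b n z :
  (forall x, 0 <= b x) -> 0 <= poisson_iter b n z.
Proof.
move=> b0; elim: n z => [|n IH] z /=; case: ifP => // _.
exact: avg_ge0.
Qed.

Lemma le_poisson_iter b b' n z : (forall x, b x <= b' x) ->
  poisson_iter b n z <= poisson_iter b' n z.
Proof.
move=> bb'; elim: n z => [|n IH] z /=; case: ifP => // _.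
exact: avg_le.
Qed.

Lemma poisson_iter_nd b z : (forall x, 0 <= b x) ->
  nondecreasing_seq (poisson_iter b ^~ z).
Proof.
move=> b0; apply/nondecreasing_seqP => n.
elim: n z => [|n IH] z.
  by rewrite /=; case: ifP => // _; apply: avg_ge0 => v; case: ifP.
have [z0|z0] := eqVneq z.2 0; first by rewrite /= z0.
by rewrite !poisson_iter_inner//; exact: avg_le.
Qed.

(** Minimum principle: the Poisson extension is the least nonnegative function
that is superharmonic off the axis and dominates the boundary values. *)
Lemma poisson_iter_le_superharmonic b h :
  (forall z, 0 <= h z) -> (forall x, b x <= h (x, 0)) ->
  (forall z, z.2 != 0 -> avg h z <= h z) ->
  forall n z, poisson_iter b n z <= h z.
Proof.
move=> h0 bh hs; elim=> [|n IH] [x y] /=; case: eqVneq => [->//|y0]//.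
by apply: le_trans (hs (x, y) y0); exact: avg_le.
Qed.

Lemma poisson_exists b : (forall x, 0 <= b x) ->
  (forall z, exists K, forall n, poisson_iter b n z <= K) ->
  exists v, poisson b v.
Proof.
move=> b0 bK; exists (fun z => limn (poisson_iter b ^~ z)) => z.
apply: nondecreasing_is_cvgn; first exact: poisson_iter_nd.
by have [K bKz] := bK z; exists K => _ [n _ <-].
Qed.

Lemma poisson_iter_le b v n z : (forall x, 0 <= b x) -> poisson b v ->
  poisson_iter b n z <= v z.
Proof.
move=> b0 bv; rewrite -(cvg_lim _ (bv z))//.
by apply: nondecreasing_cvgn_le; [exact: poisson_iter_nd|exact: cvgP (bv z)].
Qed.

Lemma poisson_boundary b v x : poisson b v -> v (x, 0) = b x.
Proof.
move=> /(_ (x, 0)); under eq_fun do rewrite poisson_iter_boundary.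
by move=> bv; apply: (cvgn_unique bv); exact: cvg_cst.
Qed.

Lemma poisson_harmonic b v z : poisson b v -> z.2 != 0 -> avg v z = v z.
Proof.
move=> bv z0; apply: (cvgn_unique (@cvg_avg _ (poisson_iter b) v z bv)).
have := bv z; rewrite -(cvg_shiftS (poisson_iter b ^~ z)).
by under eq_fun do rewrite poisson_iter_inner//.
Qed.

Lemma le_poisson b b' v v' z : poisson b v -> poisson b' v' ->
  (forall x, b x <= b' x) -> v z <= v' z.
Proof.
move=> bv bv' bb'; apply: (ler_cvg_to (bv z) (bv' z)).
by apply: nearW => n; exact: le_poisson_iter.
Qed.

Lemma poisson_le_superharmonic b v h : poisson b v ->
  (forall z, 0 <= h z) -> (forall x, b x <= h (x, 0)) ->
  (forall z, z.2 != 0 -> avg h z <= h z) -> forall z, v z <= h z.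
Proof.
move=> bv h0 bh hs z; apply: (cvgr_to_le (bv z)); apply: nearW => n.
exact: poisson_iter_le_superharmonic.
Qed.

Lemma poisson_ge0 b v z : poisson b v -> (forall x, 0 <= b x) -> 0 <= v z.
Proof.
move=> bv b0; apply: (cvgr_to_ge (bv z)); apply: nearW => n.
exact: poisson_iter_ge0.
Qed.

Lemma poissonD b b' v v' : poisson b v -> poisson b' v' ->
  poisson (b \+ b') (v \+ v').
Proof.
move=> bv bv' z; have := cvgD (bv z) (bv' z).
rewrite (_ : poisson_iter b ^~ z + poisson_iter b' ^~ z =
  poisson_iter (b \+ b') ^~ z); first by apply.
apply/funext => n; rewrite fctE.
elim: n z => [|n IH] z /=; case: ifP => // _; first by rewrite addr0.
by rewrite -avgD; congr (avg _ z); apply/funext => w; exact: IH.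
Qed.

Lemma poissonZ c b v : poisson b v -> poisson (c \*: b) (c \*: v).
Proof.
move=> bv z; have := @cvgMl_tmp _ _ _ _ _ c _ (bv z).
rewrite (_ : (fun _ => _) = poisson_iter (c \*: b) ^~ z); first by apply.
apply/funext => n.
elim: n z => [|n IH] z /=; case: ifP => // _; first by rewrite mulr0.
by rewrite -avgZ; congr (avg _ z); apply/funext => w; exact: IH.
Qed.

Lemma poisson_iter_translate a b n z :
  poisson_iter (fun x => b (x + a)) n z = poisson_iter b n (translate a z).
Proof.
elim: n z => [//|n IH] z /=; case: ifP => // _.
by rewrite -avg_translate; congr (avg _ z); apply/funext.
Qed.

Lemma poisson_translate a b v : poisson b v ->
  poisson (fun x => b (x + a)) (v \o translate a).
Proof.
by move=> bv z; under eq_fun do rewrite poisson_iter_translate; exact: bv.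
Qed.

Lemma poisson_iter_reflect0 b n z :
  poisson_iter (fun x => b (- x)) n z = poisson_iter b n (reflect0 z).
Proof.
elim: n z => [|n IH] z /=; rewrite oppr_eq0; case: ifP => // _.
by rewrite -avg_reflect0; congr (avg _ z); apply/funext.
Qed.

Lemma poisson_reflect0 b v : poisson b v ->
  poisson (fun x => b (- x)) (v \o reflect0).
Proof.
by move=> bv z; under eq_fun do rewrite poisson_iter_reflect0; exact: bv.
Qed.

(** Recurrence of the vertical motion. The extension v of 1 is at most 1 and by
translation invariance depends on y only; for y >= 0 it is then affine in y,
with value 1 at 0, and nonnegative, so its slope is 0. *)
Lemma poisson_cst c : poisson (fun=> c) (fun=> c).
Proof.
suff p1 : poisson (fun=> 1) (fun=> 1).
  by have := @poissonZ c _ _ p1; rewrite /GRing.scale_fun /= /GRing.scale/= mulr1.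
have le1 n z : poisson_iter (fun=> 1) n z <= 1.
  by apply: (@poisson_iter_le_superharmonic _ (fun=> 1)) => // w _; rewrite avg_cst.
have [v pv] : exists v, poisson (fun=> 1) v.
  by apply: poisson_exists => // z; exists 1 => n; exact: le1.
have v1 z : v z <= 1.
  by apply: (cvgr_to_le (pv z)); apply: nearW => n; exact: le1.
have v0 z : 0 <= v z by apply: poisson_ge0 pv _.
have vx x y : v (x, y) = v (0, y).
  rewrite -[x in LHS]add0r.
  exact: cvgn_unique (@poisson_translate x _ _ pv (0, y)) (pv (0, y)).
have w0 : v (0, 0) = 1 by rewrite (poisson_boundary _ pv).
have lin (y : nat) : v (0, y.+2%:Z) = 2 * v (0, y.+1%:Z) - v (0, y%:Z).
  have := poisson_harmonic pv (isT : (0, y.+1%:Z).2 != 0).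
  rewrite avg_gt0E// add0r (vx 1).
  rewrite (_ : y.+1%:Z + 1 = y.+2%:Z); last lia.
  rewrite (_ : y.+1%:Z - 1 = y%:Z); last lia.
  lra.
have affine y : v (0, y%:Z) = 1 + y%:R * (v (0, 1) - 1).
  suff : v (0, y%:Z) = 1 + y%:R * (v (0, 1) - 1) /\
         v (0, y.+1%:Z) = 1 + y.+1%:R * (v (0, 1) - 1) by case.
  elim: y => [|y [IH1 IH2]]; first by rewrite w0; split; ring.
  by split=> //; rewrite lin IH1 IH2 -!natr1; ring.
have w1 : v (0, 1) = 1.
  apply/eqP; rewrite eq_le v1/= leNgt; apply/negP => w1.
  have [n] : exists n : nat, 1 < n%:R * (1 - v (0, 1)).
    exists (Num.truncn (1 / (1 - v (0, 1)))).+1.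
    by rewrite -ltr_pdivrMr ?subr_gt0// truncnS_gt.
  by have := v0 (0, n%:Z); rewrite affine; lra.
have up (y : nat) : v (0, y%:Z) = 1 by rewrite affine w1; ring.
suff -> : (fun=> 1) = v by [].
apply/funext => -[x y]; rewrite vx.
have [y0|y0] := leP 0 y.
  by case: y y0 => // n _; rewrite up.
have vr : v (0, y) = v (0, - y).
  have := cvgn_unique (pv (0, y)) (@poisson_reflect0 _ _ pv (0, y)).
  by rewrite /reflect0/= oppr0.
by rewrite vr; case: y y0 {vr} => // n _; rewrite NegzE opprK up.
Qed.

End Poisson.

(** * Nonnegative harmonic functions of the walk are constant *)

Section Harmonic.
Context {R : realType}.
Implicit Types (v h : state -> R).

Definition walk_harmonic h := forall u, avg h u = h u.

Lemma harmonic_translate a h : walk_harmonic h -> walk_harmonic (h \o translate a).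
Proof. by move=> hh u; rewrite avg_translate hh. Qed.

Lemma harmonic_reflect0 h : walk_harmonic h -> walk_harmonic (h \o reflect0).
Proof. by move=> hh u; rewrite avg_reflect0 hh. Qed.

Section Defect.
Variables (h v : state -> R).
Hypotheses (h0 : forall z, 0 <= h z) (hh : walk_harmonic h).
Hypothesis (hv : poisson (fun x => h (x, 0)) v).

Lemma poisson_le_harmonic z : v z <= h z.
Proof. by apply: (poisson_le_superharmonic hv) => // w _; rewrite hh. Qed.

Lemma poisson_defect_nonincreasing (x y : int) :
  0 <= y -> h (x + 1, y) - v (x + 1, y) <= h (x, y) - v (x, y).
Proof.
apply: (@half_plane_nonincreasing _ (h \- v)) => {y}.
- by move=> x' y' _; rewrite subr_ge0 poisson_le_harmonic.
- by move=> x'; rewrite /= (poisson_boundary _ hv) subrr.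
- by move=> x' y' y'0; rewrite avgB hh (poisson_harmonic hv)//= gt_eqF.
Qed.

Lemma poisson_defect_le_left (n : nat) (x y : int) : 0 <= y ->
  h (x, y) - v (x, y) <= h (x - n%:Z, y) - v (x - n%:Z, y).
Proof.
move=> y0; elim: n => [|n IH]; first by rewrite subr0.
apply: (le_trans IH); have := poisson_defect_nonincreasing (x - n.+1%:Z) y0.
by rewrite (_ : x - n.+1%:Z + 1 = x - n%:Z)//; lia.
Qed.

End Defect.

(** Symmetrizing is what makes the monotonicity of the defect usable on the whole
axis: for every x, one of x and - x is nonpositive, and there the defect at height
1 is at least its value at (0, 1). *)
Lemma poisson_defect_eq0 h v : (forall z, 0 <= h z) -> walk_harmonic h ->
  poisson (fun x => h (x, 0)) v -> h (0, 1) = v (0, 1).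
Proof.
move=> h0 hh hv.
have hvR := @poisson_reflect0 _ _ _ hv.
apply/eqP; rewrite eq_le (poisson_le_harmonic h0 hh hv) andbT.
rewrite leNgt; apply/negP => vh.
set a := h (0, 1) - v (0, 1); have a0 : 0 < a by rewrite subr_gt0.
pose k x := h (x, 0) + h (- x, 0).
have pk : poisson k (v \+ (v \o reflect0)) := poissonD hv hvR.
have kinf : has_inf (range k).
  by split; [exists (k 0), 0|exists 0 => _ [x _ <-]; exact: addr_ge0].
have km x : inf (range k) <= k x by apply: ge_inf; [exact: kinf.2|exists x].
(* The constant inf k is its own Poisson extension. *)
have vm z : inf (range k) <= v z + v (reflect0 z).
  exact: (le_poisson z (@poisson_cst _ (inf (range k))) pk km).
(* One step of the walk from the axis gains a / 2 over the infimum. *)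
suff : inf (range k) + a / 2 <= inf (range k) by lra.
apply: lb_le_inf; first exact: kinf.1.
move=> _ [x _ <-]; rewrite /k -(hh (x, 0)) -(hh (- x, 0)) !avg0E.
have := vm (x, 1); have := vm (- x, 1); rewrite /reflect0/= opprK.
have d0 z : v z <= h z by exact: poisson_le_harmonic.
have := d0 (x, 1); have := d0 (- x, 1); have := d0 (x, -1); have := d0 (- x, -1).
suff : a <= (h (x, 1) - v (x, 1)) + (h (- x, 1) - v (- x, 1)) by lra.
have := d0 (x, 1); have := d0 (- x, 1); rewrite /a.
have defect n := poisson_defect_le_left h0 hh hv n 0 (ler01 : 0 <= 1 :> int).
case: x => n; [have := defect n|have := defect n.+1].
  by rewrite sub0r; lra.
by rewrite sub0r -NegzE; lra.
Qed.

(** Two functions that are harmonic above the axis and agree at heights 0 and 1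
agree above the axis: the walk equation at height n + 1 determines the values at
height n + 2. *)
Lemma upper_harmonic_eq_poisson h v : (forall z, 0 <= h z) -> walk_harmonic h ->
  poisson (fun x => h (x, 0)) v -> forall x (n : nat), h (x, n%:Z) = v (x, n%:Z).
Proof.
move=> h0 hh hv x n.
have hv0 x' : h (x', 0) = v (x', 0) by rewrite (poisson_boundary _ hv).
have hv1 x' : h (x', 1) = v (x', 1).
  have := @poisson_defect_eq0 (h \o translate x') (v \o translate x').
  rewrite /= /translate/= add0r; apply => //.
    exact: harmonic_translate.
  exact: poisson_translate hv.
suff : forall x, h (x, n%:Z) = v (x, n%:Z) /\ h (x, n.+1%:Z) = v (x, n.+1%:Z).
  by move=> /(_ x)[].
elim: n {x} => [//|n IH] x; split; first exact: (IH x).2.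
have := hh (x, n.+1%:Z).
have := poisson_harmonic hv (isT : (x, n.+1%:Z).2 != 0).
rewrite !avg_gt0E// (_ : n.+1%:Z + 1 = n.+2%:Z); last lia.
rewrite (_ : n.+1%:Z - 1 = n%:Z); last lia.
by have [-> ->] := IH x; have [_ ->] := IH (x + 1); lra.
Qed.

Lemma harmonic_eq_poisson h : (forall z, 0 <= h z) -> walk_harmonic h ->
  poisson (fun x => h (x, 0)) h.
Proof.
move=> h0 hh.
have [v hv] : exists v, poisson (fun x => h (x, 0)) v.
  apply: poisson_exists => // z; exists (h z) => n.
  by apply: poisson_iter_le_superharmonic => // w _; rewrite hh.
suff hE : h = v by rewrite -hE in hv.
apply/funext => -[x [n|n]]; first exact: upper_harmonic_eq_poisson.
have := @upper_harmonic_eq_poisson (h \o reflect0) (v \o reflect0).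
move=> /(_ _ _ _ (- x) n.+1); rewrite /= /reflect0/= opprK -NegzE; apply => //.
  exact: harmonic_reflect0.
exact: poisson_reflect0 hv.
Qed.

(** The constant is first bounded by 18, the inverse of the probability
1/2 * 1/3 * 1/3 of the path up, right, down from (x, 0) to (x + 1, 0). A gain e
at height 1 becomes a gain e / 6 on the axis: the step from (x, 0) to (x, 1) has
weight 1/2, and h (x, 1) >= h (x, 0) / 3. *)
Lemma axis_nonincreasing h : (forall z, 0 <= h z) -> walk_harmonic h ->
  forall x, h (x + 1, 0) <= h (x, 0).
Proof.
move=> h0 hh x; have hp := harmonic_eq_poisson h0 hh.
have h1 x' : h (x', 0) <= 3 * h (x', 1).
  rewrite -(hh (x', 1)) avg_gt0E//.
  have := h0 (x', 1 + 1); have := h0 (x' + 1, 1); rewrite subrr; lra.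
apply: (@le_of_ratio_descent _ _ setT (fun x => h (x, 0))
  (fun x => h (x + 1, 0)) 18 _ _ _ x I).
- by move=> *; exact: h0.
- move=> {}x _; have := hh (x, 0); have := hh (x, 1); rewrite avg0E avg_gt0E//.
  have := h1 (x + 1); have := h0 (x, 1 + 1); have := h0 (x, 1 - 1).
  have := h0 (x, -1); lra.
- move=> c c1 hc; have [e e0 He] := no_supercritical_growth c1.
  have Thc z : h (translate 1 z) <= c * h z.
    apply: (le_poisson z (poisson_translate (a := 1) hp) (poissonZ (c := c) hp)).
    by move=> x'; exact: hc.
  exists (e / 6) => [|{}x _]; first by rewrite divr_gt0.
  have up : h (x + 1, 1) <= (c - e) * h (x, 1).
    by apply: He => // x' y'; [move=> _; exact: Thc (x', y')].
  have := Thc (x, -1); rewrite /translate/=.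
  rewrite -(hh (x, 0)) -(hh (x + 1, 0)) !avg0E.
  have := h1 x; rewrite -{1}(hh (x, 0)) avg0E; nra.
Qed.

Theorem nonneg_harmonic_cst h : (forall z, 0 <= h z) -> walk_harmonic h ->
  forall z, h z = h (0, 0).
Proof.
move=> h0 hh z.
have inc x : h (x + 1, 0) = h (x, 0).
  apply/eqP; rewrite eq_le axis_nonincreasing//=.
  have := @axis_nonincreasing (h \o reflect0).
  move=> /(_ _ _ (- x - 1)); rewrite /= /reflect0/= subrK opprK opprB opprK oppr0.
  by rewrite addrC; apply => //; exact: harmonic_reflect0.
have axis x : h (x, 0) = h (0, 0).
  elim/int_rec: x => // n IH; first by rewrite intS addrC inc.
  by rewrite -inc intS opprD addrAC addNr add0r.
have hp := harmonic_eq_poisson h0 hh.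
apply: (cvgn_unique (hp z)).
rewrite (_ : (fun x => h (x, 0)) = fun=> h (0, 0)); last exact/funext.
exact: poisson_cst.
Qed.

End Harmonic.

(** * The two kernels and their harmonic functions *)

Section WalkKernel.
Context {R : realType}.
Implicit Types (h : state -> R).

Lemma outdegE u : outdeg u = size (nbrs u).
Proof.
rewrite /outdeg (_ : [set v | edge u v] = [set` [fset v in nbrs u]%fset]).
  by rewrite set_fsetK card_fseq undup_id// nbrs_uniq.
by apply/seteqP; split=> v /=; rewrite !inE /= edgeE.
Qed.

Lemma sum_walk_kernel h u :
  \sum_(v <- nbrs u) walk_kernel R u v * h v = avg h u.
Proof.
rewrite /avg mulrC mulr_sumr; apply: eq_big_seq => v vu.
by rewrite /walk_kernel edgeE vu outdegE.
Qed.

Lemma esum_walk_kernel h u : (forall v, 0 <= h v) ->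
  \esum_(v in [set: state]) (walk_kernel R u v * h v)%:E = (avg h u)%:E.
Proof.
move=> h0; have k0 v : (0 <= (walk_kernel R u v * h v)%:E)%E.
  by rewrite lee_fin mulr_ge0// /walk_kernel; case: ifP.
rewrite -sum_walk_kernel -sumEFin fsbig_seq ?nbrs_uniq// -esum_fset//.
rewrite [RHS]esum_mkcond; apply: eq_esum => v _; case: ifPn => //.
by rewrite notin_setE/= /walk_kernel edgeE => /negP/negPf ->; rewrite mul0r.
Qed.

Lemma positive_harmonic_walkE h : positive_harmonic (walk_kernel R) h <->
  (forall u, 0 <= h u) /\ walk_harmonic h.
Proof.
split=> -[h0 hh]; split=> // u.
  by apply: EFin_inj; rewrite -esum_walk_kernel.
by rewrite esum_walk_kernel// hh.
Qed.

Theorem walk_trivial : trivial_martin_boundary (walk_kernel R).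
Proof.
move=> h; rewrite positive_harmonic_walkE; split=> [[h0 hh]|[c c0 hc]].
  by exists (h (0, 0)) => //; exact: nonneg_harmonic_cst.
have -> : h = fun=> c by exact/funext.
by split=> // u; exact: avg_cst.
Qed.

End WalkKernel.

Section Extension.
Context {R : realType}.
Implicit Types (b : int -> R).

(** A bound on the average over (x, 1) and (x, -1) bounds the iterates at height
1; a bound at one height passes to the next by Harnack's inequality. *)
Lemma poisson_iter_bounded_upper b : (forall x, 0 <= b x) ->
  (forall n x, avg (poisson_iter b n) (x, 0) <= b x) ->
  forall (y : nat) x, exists K, forall n, poisson_iter b n (x, y%:Z) <= K.
Proof.
move=> b0 bK; have it0 n z : 0 <= poisson_iter b n z by exact: poisson_iter_ge0.
have step (y : nat) x n :
    poisson_iter b n (x, y.+2%:Z) <= 3 * poisson_iter b n.+1 (x, y.+1%:Z).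
  rewrite poisson_iter_inner// avg_gt0E//.
  rewrite (_ : y.+1%:Z + 1 = y.+2%:Z); last lia.
  have := it0 n (x, y.+1%:Z - 1); have := it0 n (x + 1, y.+1%:Z); lra.
case=> [|y] x; first by exists (b x) => n; rewrite poisson_iter_boundary.
elim: y => [|y [K IH]].
  exists (2 * b x) => n; have := bK n x; rewrite avg0E.
  by have := it0 n (x, -1); lra.
by exists (3 * K) => n; have := step y x n; have := IH n.+1; lra.
Qed.

Lemma poisson_exists_of_return b : (forall x, 0 <= b x) ->
  (forall n x, avg (poisson_iter b n) (x, 0) <= b x) -> exists v, poisson b v.
Proof.
move=> b0 bK; apply: poisson_exists => // -[x [y|y]].
  exact: poisson_iter_bounded_upper.
have [||K HK] := @poisson_iter_bounded_upper (fun x => b (- x)) _ _ y.+1 (- x).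
- by move=> x'; exact: b0.
- move=> n x'; have := bK n (- x'); congr (_ <= _).
  rewrite -[in LHS]oppr0 -/(reflect0 (x', 0)) -avg_reflect0.
  by congr (avg _ _); apply/funext => w; rewrite /= poisson_iter_reflect0.
exists K => n; have := HK n.
by rewrite poisson_iter_reflect0 /reflect0/= opprK -NegzE.
Qed.

End Extension.

Section ReturnKernel.
Context {R : realType}.
Implicit Types (b : int -> R).

Definition point_mass (v : int) : int -> R := fun x => (x == v)%:R.

(** Linearity in the boundary values, for a finite combination of point masses. *)
Lemma poisson_iter_sum b (r : seq int) n z : uniq r ->
  \sum_(v <- r) b v * poisson_iter (point_mass v) n z =
  poisson_iter (fun x => if x \in r then b x else 0) n z.
Proof.
move=> ur; have at_boundary (x : int) :
    \sum_(v <- r) b v * point_mass v x = if x \in r then b x else 0.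
  rewrite /point_mass; case: ifPn => xr.
    rewrite (bigD1_seq x)//= eqxx mulr1 big1 ?addr0// => v /negPf vx.
    by rewrite eq_sym vx mulr0.
  rewrite big_seq big1// => v vr; case: eqP => [xv|]; last by rewrite mulr0.
  by rewrite xv vr in xr.
elim: n z => [|n IH] z /=; case: ifP => _; rewrite ?at_boundary//.
  by rewrite big1// => v _; rewrite mulr0.
rewrite /avg; under eq_bigr do rewrite mulrA mulr_sumr.
rewrite -mulr_suml exchange_big/=; congr (_ / _).
by apply: eq_bigr => w _; exact: IH.
Qed.

(** The abscissas at which the walk started at z can first hit the axis within n
steps. Finiteness of this list turns the Poisson iterates into finite sums. *)
Fixpoint reach (n : nat) (z : state) : seq int :=
  if z.2 == 0 then [:: z.1]
  else if n is n'.+1 then flatten [seq reach n' w | w <- nbrs z] else [::].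

Lemma poisson_iter_local b b' n z : {in reach n z, b =1 b'} ->
  poisson_iter b n z = poisson_iter b' n z.
Proof.
elim: n z => [|n IH] z.
  by rewrite /=; case: ifP => // _ bb'; apply: bb'; rewrite mem_head.
rewrite [reach _ _]/reach -/reach [LHS]/poisson_iter [RHS]/poisson_iter.
rewrite -/poisson_iter; case: ifP => _ bb'.
  by apply: bb'; rewrite mem_head.
rewrite /avg; congr (_ / _); apply: eq_big_seq => w wz; apply: IH => v vw.
by apply: bb'; apply/flatten_mapP; exists w.
Qed.

Lemma avg_poisson_iter_sum b (r : seq int) n z : uniq r ->
  \sum_(v <- r) b v * avg (poisson_iter (point_mass v) n) z =
  avg (poisson_iter (fun x => if x \in r then b x else 0) n) z.
Proof.
move=> ur; rewrite /avg; under eq_bigr do rewrite mulrA mulr_sumr.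
rewrite -mulr_suml exchange_big/=; congr (_ / _).
by apply: eq_bigr => w _; exact: poisson_iter_sum.
Qed.

(** The only property of the return kernel used here: it is the limit of the
probabilities of a first return within n + 1 steps. *)
Variable p : int -> int -> R.
Hypothesis pE : forall x v,
  avg (poisson_iter (point_mass v) n) (x, 0) @[n --> \oo] --> p x v.

Lemma return_kernel_ge n x v :
  avg (poisson_iter (point_mass v) n) (x, 0) <= p x v.
Proof.
have nd : nondecreasing_seq
    (fun n => avg (poisson_iter (point_mass v) n) (x, 0)).
  move=> i j ij; apply: avg_le => w; apply: poisson_iter_nd ij => y.
  exact: ler0n.
rewrite -(cvg_lim _ (@pE x v))//; apply: nondecreasing_cvgn_le => //.
exact: cvgP (@pE x v).
Qed.

Lemma esum_return_kernel_ge b n x : (forall v, 0 <= b v) ->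
  ((avg (poisson_iter b n) (x, 0))%:E <=
   \esum_(v in [set: int]) (p x v * b v)%:E)%E.
Proof.
move=> b0; pose r := undup (flatten [seq reach n w | w <- nbrs (x, 0)]).
rewrite (_ : avg _ _ =
    \sum_(v <- r) b v * avg (poisson_iter (point_mass v) n) (x, 0)); last first.
  rewrite avg_poisson_iter_sum ?undup_uniq// /avg; congr (_ / _).
  apply: eq_big_seq => w wz; apply: poisson_iter_local => v vw.
  by rewrite ifT// mem_undup; apply/flatten_mapP; exists w.
apply: esum_ge; exists [set` r]; first by split => //; exact: finite_seq.
rewrite -fsbig_seq ?undup_uniq// sumEFin lee_fin.
apply: ler_sum => v _; rewrite mulrC; apply: ler_wpM2r => //.
exact: return_kernel_ge.
Qed.

Lemma esum_return_kernel_le b K x : (forall v, 0 <= b v) ->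
  (forall n, avg (poisson_iter b n) (x, 0) <= K) ->
  (\esum_(v in [set: int]) (p x v * b v)%:E <= K%:E)%E.
Proof.
move=> b0 bK; apply: ge_ereal_sup => _ [X [finX _] <-].
rewrite fsbig_finite//= sumEFin lee_fin.
set r := enum_fset (fset_set X).
have cvgr : \sum_(v <- r) b v * avg (poisson_iter (point_mass v) n) (x, 0)
    @[n --> \oo] --> \sum_(v <- r) p x v * b v.
  elim: (r) => [|v s IHs].
    by rewrite big_nil; under eq_fun do rewrite big_nil; exact: cvg_cst.
  rewrite big_cons; under eq_fun do rewrite big_cons.
  by apply: cvgD => //; rewrite mulrC; apply: cvgMl_tmp; exact: pE.
apply: (cvgr_to_le cvgr); apply: nearW => n.
apply: le_trans (bK n); rewrite avg_poisson_iter_sum ?fset_uniq//.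
apply: avg_le => w; apply: le_poisson_iter => v; by case: ifP.
Qed.

(** The Markov property at the first step from the axis. Both sides are
monotone limits, over finite sets of end points and over the number of steps. *)
Lemma esum_return_kernel b v x : (forall y, 0 <= b y) -> poisson b v ->
  \esum_(y in [set: int]) (p x y * b y)%:E = (avg v (x, 0))%:E.
Proof.
move=> b0 bv; have le_s : (\esum_(y in [set: int]) (p x y * b y)%:E <=
    (avg v (x, 0))%:E)%E.
  apply: esum_return_kernel_le => // n; apply: avg_le => w.
  exact: poisson_iter_le.
apply/eqP; rewrite eq_le le_s /=.
case: (\esum_(_ in _) _) le_s (fun n => esum_return_kernel_ge n x b0) =>
  [s _ ge_s|//|_ /(_ 0%N)]; last by rewrite leeNy_eq.
rewrite lee_fin; apply: (cvgr_to_le (@cvg_avg _ _ _ (x, 0) bv)).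
by apply: nearW => n; rewrite -lee_fin.
Qed.

Theorem return_trivial : trivial_martin_boundary p.
Proof.
move=> b; split=> [[b0 bh]|[c c0 bc]]; last first.
  have -> : b = fun=> c by exact/funext.
  split=> // x; rewrite (@esum_return_kernel _ (fun=> c)) ?avg_cst//.
  exact: poisson_cst.
have [v bv] : exists v, poisson b v.
  apply: poisson_exists_of_return => // n x.
  by rewrite -lee_fin -bh; exact: esum_return_kernel_ge.
have v0 z : 0 <= v z by exact: poisson_ge0 bv _.
exists (b 0) => // x; rewrite -!(poisson_boundary _ bv).
apply: nonneg_harmonic_cst => // -[x' y].
have [->|y0] := eqVneq y 0; last exact: poisson_harmonic bv _.
apply: EFin_inj; rewrite -(esum_return_kernel _ b0 bv) bh.
by rewrite (poisson_boundary _ bv).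
Qed.

End ReturnKernel.

(** * First return of the walk to the axis *)

Section WalkPaths.
Context {R : realType} {d : measure_display} {Omega : measurableType d}.
Variables (P : state -> probability Omega R) (M : nat -> Omega -> state).
Hypothesis HM : markov_chain (walk_kernel R) P M.

Definition cylinder (x : nat -> state) (n : nat) : set Omega :=
  [set w | forall i, (i <= n)%N -> M i w = x i].

Definition extend (x : nat -> state) (n : nat) (v : state) : nat -> state :=
  fun i => if (i <= n)%N then x i else v.

Lemma measurable_walk n (S : set state) : measurable (M n @^-1` S).
Proof.
have [mM _ _] := HM.
rewrite (_ : _ @^-1` _ = \bigcup_(v : state) (M n @^-1` [set v] `&` [set _ | S v])).
  apply: countable_bigcupT_measurable => [|v]; first exact: countableP.
  have [Sv|nSv] := pselect (S v).
    rewrite (_ : [set _ | _] = setT); last by apply/seteqP; split.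
    by rewrite setIT.
  rewrite (_ : [set _ | _] = set0); last by apply/seteqP; split.
  by rewrite setI0.
apply/seteqP; split=> w /=.
  by move=> Sw; exists (M n w).
by move=> [v _ [/= -> ]].
Qed.

Lemma extend_cylinder x n v :
  cylinder (extend x n v) n.+1 = cylinder x n `&` M n.+1 @^-1` [set v].
Proof.
rewrite /cylinder /extend; apply/seteqP; split=> w /=.
  move=> xw; split; last by rewrite xw// ltnn.
  by move=> i i_n; rewrite xw ?i_n// ltnW.
move=> [xw wv] i; rewrite leq_eqVlt => /predU1P[->|]; first by rewrite ltnn.
by rewrite ltnS => i_n; rewrite i_n xw.
Qed.

Lemma measurable_cylinder x n : measurable (cylinder x n).
Proof.
elim: n => [|n IH].
  rewrite (_ : cylinder x 0 = M 0%N @^-1` [set x 0%N]).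
    exact: measurable_walk.
  apply/seteqP; split=> w /=; first exact.
  by move=> xw i; rewrite leqn0 => /eqP ->.
have -> : cylinder x n.+1 = cylinder (extend x n (x n.+1)) n.+1.
  apply/seteqP; split=> w xw i i_n; rewrite xw// /extend; case: ifPn => //;
    by rewrite -ltnNge => ni; congr x; apply/eqP; rewrite eqn_leq i_n ni.
rewrite extend_cylinder; apply: measurableI => //; exact: measurable_walk.
Qed.

Lemma prob_extend_cylinder u x n v :
  P u (cylinder (extend x n v) n.+1) =
  (P u (cylinder x n) * (walk_kernel R (x n) v)%:E)%E.
Proof.
have [_ _ step] := HM.
rewrite /cylinder step; congr (_ * _)%E; last first.
  by rewrite /extend leqnn ltnn.
congr (P u _); apply/seteqP; split=> w xw i i_n; have := xw i i_n;
  by rewrite /extend i_n.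
Qed.

(** The transition probabilities to the out-neighbours add up to 1, so the
cylinders extended by an out-neighbour exhaust the given cylinder up to a null
set. *)
Lemma measure_cylinder_split u x n (E : set Omega) : measurable E ->
  P u (cylinder x n `&` E) =
  \sum_(v <- nbrs (x n)) P u (cylinder (extend x n v) n.+1 `&` E).
Proof.
move=> mE.
pose next := \bigcup_(v in [set` nbrs (x n)]) cylinder (extend x n v) n.+1.
have sum_next (F : set Omega) : measurable F ->
    P u (next `&` F) =
    \sum_(v <- nbrs (x n)) P u (cylinder (extend x n v) n.+1 `&` F).
  move=> mF; rewrite setI_bigcupl measure_fin_bigcup.
  - by rewrite -fsbig_seq// nbrs_uniq.
  - exact: finite_seq.
  - apply/trivIsetP => v v' _ _ vv'; apply/seteqP; split=> w //=.
    rewrite !extend_cylinder => -[[[_ /= wv] _] [[_ /= wv'] _]].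
    by move: vv'; rewrite -wv -wv' eqxx.
  - by move=> v _; apply: measurableI => //; exact: measurable_cylinder.
have mnext : measurable next.
  apply: fin_bigcup_measurable; first exact: finite_seq.
  by move=> v _; exact: measurable_cylinder.
have next_sub : next `<=` cylinder x n.
  by move=> w [v _]; rewrite extend_cylinder => -[].
have mC := measurable_cylinder x n.
have Pnext : P u next = P u (cylinder x n).
  have := sum_next setT measurableT; rewrite setIT => ->.
  under eq_bigr do rewrite setIT prob_extend_cylinder.
  rewrite -ge0_sume_distrr; last first.
    by move=> v _; rewrite lee_fin /walk_kernel; case: ifP.
  rewrite sumEFin (_ : \sum_(_ <- _) _ = 1) ?mule1//.
  have := @sum_walk_kernel R (fun=> 1) (x n).
  by rewrite avg_cst => <-; apply: eq_bigr => v _; rewrite mulr1.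
have null : P u (cylinder x n `\` next) = 0.
  transitivity (P u (cylinder x n) - P u next)%E; last first.
    by rewrite Pnext subee// fin_num_measure.
  rewrite measureD// ?(setIidr next_sub)//.
  by rewrite ltey_eq fin_num_measure.
have mD : measurable (cylinder x n `\` next) by exact: measurableD.
have nullE : P u ((cylinder x n `\` next) `&` E) = 0.
  apply: (subset_measure0 (measurableI _ _ mD mE) mD) null.
  exact: subIsetl.
rewrite -sum_next//.
rewrite (_ : cylinder x n `&` E =
    (next `&` E) `|` ((cylinder x n `\` next) `&` E)); last first.
  apply/seteqP; split=> w.
    move=> [xw Ew]; have [nw|nw] := pselect (next w); first by left.
    by right.
  by case=> [[/next_sub nw Ew]|[[]]].
by rewrite measureU0//; exact: measurableI.
Qed.

(** The event that the first visit to the axis at or after time m happens by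
time m + n, at (v, 0). The recursion on n matches that of the Poisson
iterates. *)
Fixpoint first_hit (n m : nat) (v : int) : set Omega :=
  M m @^-1` [set (v, 0)] `|`
  (if n is n'.+1 then M m @^-1` [set z | z.2 != 0] `&` first_hit n' m.+1 v
   else set0).

Lemma measurable_first_hit n m v : measurable (first_hit n m v).
Proof.
elim: n m => [|n IH] m; (apply: measurableU; first exact: measurable_walk).
  exact: measurable0.
by apply: measurableI; [exact: measurable_walk|exact: IH].
Qed.

(** Induction on n, for all paths at once: splitting a cylinder according to the
next position reproduces the averaging step of the Poisson iterates. Working
with cylinders makes the hypothesis on the law of finite paths sufficient. *)
Lemma prob_first_hit u x n m v :
  P u (cylinder x m `&` first_hit n m v) =
  (P u (cylinder x m) * (poisson_iter (point_mass v) n (x m))%:E)%E.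
Proof.
have on_axis n' x' m' : (x' m').2 = 0 ->
    P u (cylinder x' m' `&` first_hit n' m' v) =
    (P u (cylinder x' m') * (poisson_iter (point_mass v) n' (x' m'))%:E)%E.
  move=> x0.
  have -> : poisson_iter (point_mass v) n' (x' m') = point_mass v (x' m').1.
    by case: n' => [|n'] /=; rewrite x0.
  rewrite /point_mass; case: (eqVneq (x' m').1 v) => [x1|x1] /=.
    rewrite mule1; congr (P u _); apply/seteqP; split=> w; first by case.
    move=> xw; split => //; have := xw m' (leqnn _).
    have -> : x' m' = (v, 0) by move: x0 x1; case: (x' m') => a b /= -> ->.
    by case: n' => [|n'] wm; left.
  rewrite mule0 (_ : _ `&` _ = set0) ?measure0//.
  apply/seteqP; split=> w //= -[/(_ m' (leqnn _)) wm].
  case: n' => [|n'] [|]//=; rewrite wm; try by move=> xE; rewrite xE eqxx in x1.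
  by rewrite x0 eqxx => -[].
elim: n x m => [|n IH] x m; have [x0|x0] := eqVneq (x m).2 0;
  try exact: on_axis.
  rewrite /= (negPf x0) mule0 (_ : _ `&` _ = set0) ?measure0//.
  apply/seteqP; split=> w //= -[/(_ m (leqnn _)) wm]; rewrite wm => -[]// xE.
  by rewrite xE eqxx in x0.
rewrite poisson_iter_inner//.
rewrite (_ : cylinder x m `&` _ = cylinder x m `&` first_hit n m.+1 v); last first.
  apply/seteqP; split=> w /= [xw]; have wm := xw m (leqnn _).
    by rewrite wm => -[xE|[_]//]; rewrite xE eqxx in x0.
  by move=> hw; split => //; right; rewrite wm.
rewrite measure_cylinder_split; last exact: measurable_first_hit.
rewrite -sum_walk_kernel -sumEFin ge0_sume_distrr; last first.
  move=> w _; rewrite lee_fin mulr_ge0//.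
    by rewrite /walk_kernel; case: ifP.
  by apply: poisson_iter_ge0 => y; exact: ler0n.
apply: eq_bigr => w _; rewrite IH prob_extend_cylinder EFinM muleA.
by rewrite /extend ltnn.
Qed.

Lemma first_hitP n m v w : first_hit n m v w <->
  exists k, [/\ (k <= n)%N, M (m + k)%N w = (v, 0) &
    forall j, (j < k)%N -> (M (m + j)%N w).2 != 0].
Proof.
elim: n m => [|n IH] m /=.
  split=> [[wm|//]|[k [+ + _]]]; first by exists 0%N; rewrite addn0.
  by rewrite leqn0 => /eqP ->; rewrite addn0; left.
split=> [[wm|[/= wm /IH[k [kn wk nk]]]]|[[|k] [kn wk nk]]].
- by exists 0%N; rewrite addn0.
- exists k.+1; rewrite addnS -addSn; split=> // -[|j]; first by rewrite addn0.
  by rewrite ltnS addnS -addSn; exact: nk.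
- by left; rewrite addn0 in wk.
- right; split=> /=; first by have := nk 0%N isT; rewrite addn0.
  apply/IH; exists k; rewrite addSn -addnS; split=> // j jk.
  by rewrite addSn -addnS; exact: nk.
Qed.

Lemma induced_chain1P v w :
  induced_chain M 1 w = Some (v, 0) <-> exists n, first_hit n 1 v w.
Proof.
rewrite /induced_chain /= /inf_time; case: pselect => [exA|noA]; last first.
  split=> [//|[n /first_hitP[k [_ wk _]]]]; exfalso; apply: noA.
  by exists k.+1; rewrite /= -add1n wk eqxx.
case: ex_minnP => t /andP[t1 /eqP t0] tmin /=; split=> [[wt]|].
  exists t; apply/first_hitP; exists t.-1; rewrite add1n prednK//.
  split=> [||j jt]; [exact: leq_pred|exact: wt|apply/negP => j0].
  by have := tmin j.+1; rewrite /= -add1n j0 => /(_ isT); lia.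
move=> [n /first_hitP[k [_ wk nk]]].
suff -> : t = (1 + k)%N by rewrite wk.
have := tmin k.+1; rewrite /= -add1n wk eqxx => /(_ isT); rewrite leq_eqVlt.
move=> /predU1P[//|tk]; have := nk t.-1.
by rewrite add1n prednK// t0 eqxx => nkt; have := nkt ltac:(lia).
Qed.

Lemma prob_first_return n x v : P (x, 0) (first_hit n 1 v) =
  (avg (poisson_iter (point_mass v) n) (x, 0))%:E.
Proof.
have [_ start _] := HM; pose c : nat -> state := fun=> (x, 0).
have c1 : P (x, 0) (cylinder c 0) = 1%E.
  rewrite -(start (x, 0)); congr (P _ _); apply/seteqP.
  split=> w /=; first by move=> ->.
  by move=> wx i; rewrite leqn0 => /eqP ->.
have mC := measurable_cylinder c 0; have mF := measurable_first_hit n 1 v.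
transitivity (P (x, 0) (cylinder c 0 `&` first_hit n 1 v)).
  rewrite setIC (measureDI _ mF mC) [X in (X + _)%E](_ : _ = 0) ?add0e//.
  have nC : P (x, 0) (~` cylinder c 0) = 0.
    by rewrite probability_setC// c1 subee.
  apply: (subset_measure0 (measurableD mF mC) (measurableC mC) _ nC).
  by move=> w [].
rewrite measure_cylinder_split// -sum_walk_kernel -sumEFin.
apply: eq_bigr => w _; rewrite prob_first_hit prob_extend_cylinder c1 mul1e.
by rewrite EFinM.
Qed.

Lemma cvg_induced_kernel x v :
  avg (poisson_iter (point_mass v) n) (x, 0) @[n --> \oo] -->
  induced_kernel P M x v.
Proof.
rewrite /induced_kernel (_ : [set w | _] = \bigcup_n first_hit n 1 v); last first.
  apply/seteqP; split=> w /=; first by move=> /induced_chain1P[n nw]; exists n.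
  by move=> [n _ nw]; apply/induced_chain1P; exists n.
have mF n : measurable (first_hit n 1 v) by exact: measurable_first_hit.
have mU : measurable (\bigcup_n first_hit n 1 v) by exact: bigcupT_measurable.
suff /fine_cvg : (avg (poisson_iter (point_mass v) n) (x, 0))%:E
    @[n --> \oo] --> (fine (P (x, 0) (\bigcup_n first_hit n 1 v)))%:E by [].
rewrite fineK ?fin_num_measure//.
have nd : nondecreasing_seq (fun n => first_hit n 1 v).
  apply/nondecreasing_seqP => n; apply/subsetPset => w.
  move=> /first_hitP[k [kn wk nk]]; apply/first_hitP; exists k.
  by split=> //; exact: leqW.
apply: cvg_trans (nondecreasing_cvg_mu (mu := P (x, 0)) mF mU nd).
by apply: near_eq_cvg; apply: nearW => n; rewrite /= prob_first_return.
Qed.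

End WalkPaths.

Theorem theorem2p1 (R : realType) (d : measure_display)
    (Omega : measurableType d) (P : state -> probability Omega R)
    (M : nat -> Omega -> state)
    (HM : markov_chain (walk_kernel R) P M) :
  trivial_martin_boundary (induced_kernel P M) /\
  trivial_martin_boundary (walk_kernel R).
Proof.
split; last exact: walk_trivial.
by apply: return_trivial => x v; exact: cvg_induced_kernel.
Qed.
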